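(* Let $C\subset\mathbb{R}^m$ be bounded, let $\Sigma\in\mathbb{R}^{m\times m}$ be symmetric positive definite, and consider the fixed-covariance Gaussian family $\pi_\mu(u)=\mathcal{N}(u;\mu,\Sigma)$, $\mu\in\mathbb{R}^m$, with $F$, $\rho_\mu$ as in the context. Let $$D_{\Sigma^{-1}}:=\sup_{u,v\in C}\|\Sigma^{-1/2}(u-v)\|,\qquad L_\Sigma:=\sup_{\mu\in\mathbb{R}^m}\left\|I-\Sigma^{-1/2}\operatorname{Cov}_{\rho_\mu}(u)\Sigma^{-1/2}\right\|.$$ Then $$L_\Sigma\le\max\left\{1,\frac{D_{\Sigma^{-1}}^2}{4}-1\right\}.$$ Consequently, whenever $0<\eta<\frac{2}{L_\Sigma}$, every sequence $\{\mu_k\}_{k\ge0}$ generated from some $\mu_0\in\mathbb{R}^m$ by the exact relaxed MPPI update $$\mu_{k+1}=(1-\eta)\mu_k+\eta\,\mathbb{E}_{\rho_{\mu_k}}[u]$$ satisfies, with $P:=\frac1\tau\Sigma$: 1. for every $k\ge0$, $F(\mu_{k+1})\le F(\mu_k)-\eta\big(1-\frac{\eta L_\Sigma}{2}\big)\|\nabla F(\mu_k)\|_P^2$; 2. $\displaystyle\sum_{k=0}^\infty\|\nabla F(\mu_k)\|_P^2\le\frac{F(\mu_0)-\inf_{\mu\in\mathbb{R}^m}F(\mu)}{\eta(1-\frac{\eta L_\Sigma}{2})}$; 3. for every $K\ge1$, $\displaystyle\min_{0\le j\le K-1}\|\nabla F(\mu_j)\|_P^2\le\frac{F(\mu_0)-\inf_{\mu\in\mathbb{R}^m}F(\mu)}{K\,\eta(1-\frac{\eta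 L_\Sigma}{2})}$, and in particular $\lim_{k\to\infty}\|\nabla F(\mu_k)\|_P=0$.
   Context: Standing assumptions: $C\subset\mathbb{R}^m$ is nonempty and compact with positive Lebesgue measure, $f_0:\mathbb{R}^m\to\mathbb{R}$ is continuous, $\tau>0$. $\mathcal{N}(u;\mu,\Sigma)$ is the Gaussian density with mean $\mu$ and covariance $\Sigma$. Define $$Z(\mu):=\int_C\pi_\mu(u)e^{-f_0(u)/\tau}\,du,\qquad F(\mu):=-\tau\log Z(\mu),\qquad\rho_\mu(u):=\frac{\pi_\mu(u)\exp(-f_0(u)/\tau)\mathbf{1}_C(u)}{Z(\mu)}.$$ Here $\rho_\mu$ is a probability density supported on $C$. The exact relaxed MPPI update is the preconditioned gradient step $\mu_{k+1}=\mu_k-\eta P\nabla F(\mu_k)$ with $P=\Sigma/\tau$. Notation: $\|\cdot\|$ is the Euclidean norm for vectors and spectral norm for matrices; $\|x\|_P^2:=x^\top Px$; $\operatorname{Cov}_{\rho}$ is the covariance matrix under $\rho$. *)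

(* Defs.v *)
From HB Require Import structures.
From mathcomp Require Import all_boot all_order all_algebra.
From mathcomp Require Import all_classical all_reals all_analysis.

Set Implicit Arguments.
Unset Strict Implicit.
Unset Printing Implicit Defensive.

Import Order.TTheory GRing.Theory Num.Theory.
Import numFieldNormedType.Exports.

Local Open Scope classical_set_scope.
Local Open Scope ring_scope.

(* The sigma-algebra on R^n generated by the coordinates, i.e. the Borel one,
   defined as the library does for n.-tuple. *)
Definition colvec_display : measure_display.
Proof. exact: default_measure_display. Qed.

Section colvec_measurable.
Context {R : realType}.
Variable n : nat.

Let coord (i : 'I_n) (v : 'cV[R]_n) : measurableTypeR R := v i 0.

Let colvec_set0 : g_sigma_preimage coord set0.
Proof. exact: sigma_algebra0. Qed.

Let colvec_setC A : g_sigma_preimage coord A -> g_sigma_preimage coord (~` A).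
Proof. exact: sigma_algebraC. Qed.

Let colvec_bigcup (F : (set 'cV[R]_n)^nat) :
  (forall i, g_sigma_preimage coord (F i)) ->
  g_sigma_preimage coord (\bigcup_i (F i)).
Proof. exact: sigma_algebra_bigcup. Qed.

HB.instance Definition _ := @isMeasurable.Build colvec_display
  'cV[R]_n (g_sigma_preimage coord) colvec_set0 colvec_setC colvec_bigcup.

Lemma measurable_coord (i : 'I_n) :
  measurable_fun [set: 'cV[R]_n] (fun v => v i 0 : measurableTypeR R).
Proof.
move=> _ Y mY; rewrite setTI; apply: sub_sigma_algebra => /=.
rewrite -bigcup_seq/=; exists i => /=; first by rewrite mem_index_enum.
by exists Y => //; rewrite setTI.
Qed.

Lemma measurable_colvecP d (T : measurableType d) (f : T -> 'cV[R]_n) :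
  (forall i, measurable_fun setT (fun x => f x i 0 : measurableTypeR R)) ->
  measurable_fun setT f.
Proof.
move=> mf.
suff H : g_sigma_preimage (fun i => coord i \o f) `<=` measurable.
  by move=> _ A mA; apply: H; rewrite g_sigma_preimage_comp; exists A.
apply: smallest_sub; first exact: sigma_algebra_measurable.
rewrite -bigcup_seq; apply: bigcup_sub => i _ _ [B mB <-].
exact: mf.
Qed.

End colvec_measurable.

(* Lebesgue measure on R^n, by recursion on n: the point mass on R^0, and on
   R^n.+1 the image of the product of the one-dimensional Lebesgue measure and
   of the Lebesgue measure on R^n under (x, v) |-> (x ; v). *)
Section lebesgue_succ.
Context {R : realType}.
Variables (n : nat) (mu : {sigma_finite_measure set 'cV[R]_n -> \bar R}).

Definition colvec_cons (p : measurableTypeR R * 'cV[R]_n) : 'cV[R]_n.+1 :=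
  col_mx (p.1%:M : 'cV[R]_1) p.2.

Let uncons (v : 'cV[R]_n.+1) : measurableTypeR R * 'cV[R]_n :=
  (v ord0 0, \col_i v (lift ord0 i) 0).

Lemma colvec_cons0 p : colvec_cons p ord0 0 = p.1.
Proof.
have -> : ord0 = lshift n (0 : 'I_1) by exact: val_inj.
by apply: etrans (col_mxEu _ _ _ _) _; rewrite mxE eqxx mulr1n.
Qed.

Lemma colvec_consS p i : colvec_cons p (lift ord0 i) 0 = p.2 i 0.
Proof.
have -> : lift ord0 i = rshift 1 i by exact: val_inj.
exact: col_mxEd.
Qed.

Lemma colvec_consK : cancel colvec_cons uncons.
Proof.
move=> [x v]; rewrite /uncons colvec_cons0; congr pair.
by apply/colP => i; rewrite mxE colvec_consS.
Qed.

Lemma colvec_unconsK : cancel uncons colvec_cons.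
Proof.
move=> v; apply/colP => i.
by case: (unliftP ord0 i) => [j ->|->]; rewrite ?colvec_consS ?colvec_cons0 ?mxE.
Qed.

Lemma measurable_colvec_cons : measurable_fun setT colvec_cons.
Proof.
apply: measurable_colvecP => i; case: (unliftP ord0 i) => [j ->|->].
  under eq_fun do rewrite colvec_consS.
  exact: measurableT_comp (measurable_coord j) measurable_snd.
under eq_fun do rewrite colvec_cons0.
exact: measurable_fst.
Qed.

Let measurable_uncons : measurable_fun setT uncons.
Proof.
apply/measurable_fun_pairP; split; first exact: measurable_coord.
apply: measurable_colvecP => i.
under eq_fun do rewrite mxE.
exact: measurable_coord.
Qed.

Definition lebesgue_succ : set 'cV[R]_n.+1 -> \bar R :=
  pushforward (@lebesgue_measure R \x mu)%E colvec_cons.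

Let lebesgue_succ_set0 : lebesgue_succ set0 = 0%E.
Proof. by rewrite /lebesgue_succ /pushforward preimage_set0 measure0. Qed.

Let lebesgue_succ_ge0 A : (0 <= lebesgue_succ A)%E.
Proof. exact: (measure_ge0 (@lebesgue_measure R \x mu)%E). Qed.

Let lebesgue_succ_sigma_additive : semi_sigma_additive lebesgue_succ.
Proof.
by apply: (@measure_semi_sigma_additive _ _ _
  (pushforward (@lebesgue_measure R \x mu)%E colvec_cons));
  exact: measurable_colvec_cons.
Qed.

HB.instance Definition _ := isMeasure.Build _ _ _ lebesgue_succ
  lebesgue_succ_set0 lebesgue_succ_ge0 lebesgue_succ_sigma_additive.

Let lebesgue_succ_sigma_finite : sigma_finite setT lebesgue_succ.
Proof.
have /sigma_finiteP[F [FT ndF Foo]] := sigma_finiteT (@lebesgue_measure R).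
have /sigma_finiteP[G [GT ndG Goo]] := sigma_finiteT mu.
exists (fun k => uncons @^-1` (F k `*` G k)).
  rewrite -preimage_bigcup (_ : \bigcup_k _ = setT) ?preimage_setT//.
  apply/seteqP; split => // -[x v] _.
  have [a _ Fx] : (\bigcup_k F k) x by rewrite -FT.
  have [b _ Gv] : (\bigcup_k G k) v by rewrite -GT.
  exists (maxn a b) => //; split => /=.
    by move: x Fx; exact/subsetPset/ndF/leq_maxl.
  by move: v Gv; exact/subsetPset/ndG/leq_maxr.
move=> k; have [mF Fk] := Foo k; have [mG Gk] := Goo k; split.
  rewrite -[X in measurable X]setTI.
  by apply: measurable_uncons => //; exact: measurableX.
rewrite /lebesgue_succ /pushforward -comp_preimage.
rewrite (_ : _ \o _ = id); last by apply/funext => p; exact: colvec_consK.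
by rewrite /= product_measure1E// lte_mul_pinfty// ge0_fin_numE.
Qed.

HB.instance Definition _ := Measure_isSigmaFinite.Build _ _ _ lebesgue_succ
  lebesgue_succ_sigma_finite.

End lebesgue_succ.

Fixpoint lebesgue_Rn {R : realType} n :
    {sigma_finite_measure set 'cV[R]_n -> \bar R} :=
  if n is k.+1 then lebesgue_succ (lebesgue_Rn k) else dirac (0 : 'cV[R]_0).

Lemma lebesgue_Rn_box {R : realType} n (A : 'I_n -> set (measurableTypeR R)) :
  (forall i, measurable (A i)) ->
  lebesgue_Rn n [set v : 'cV[R]_n | forall i, A i (v i 0)] =
  (\prod_(i < n) @lebesgue_measure R (A i))%E.
Proof.
elim: n A => [|n IH] A mA.
  by rewrite big_ord0 /= diracE mem_set// => -[].
rewrite big_ord_recl /= /lebesgue_succ /pushforward.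
have -> : @colvec_cons R n @^-1` [set v : 'cV[R]_n.+1 | forall i, A i (v i 0)] =
    A ord0 `*` [set v : 'cV[R]_n | forall i, A (lift ord0 i) (v i 0)].
  apply/seteqP; split => [p Ap|p [A0 AS]] /=.
    split => [|i]; first by have := Ap ord0; rewrite colvec_cons0.
    by have := Ap (lift ord0 i); rewrite colvec_consS.
  move=> i; case: (unliftP ord0 i) => [j ->|->].
    by rewrite colvec_consS; exact: AS.
  by rewrite colvec_cons0.
rewrite product_measure1E//.
  by congr (_ * _)%E; exact: IH.
rewrite (_ : mkset _ = \bigcap_(i in [set: 'I_n])
    ((fun v : 'cV[R]_n => v i 0 : measurableTypeR R) @^-1` A (lift ord0 i))).
  apply: fin_bigcap_measurable => [|i _]; first exact: finite_finset.
  by rewrite -[X in measurable X]setTI; exact: measurable_coord.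
by apply/seteqP; split => [v Av i _|v Av i]; [exact: Av|exact: Av].
Qed.

Section linear_algebra.
Context {R : realType}.

Definition enorm n (x : 'cV[R]_n) : R := Num.sqrt (\sum_i x i 0 ^+ 2).

Definition spectral_norm n (A : 'M[R]_n) : R :=
  sup [set enorm (A *m x) | x in [set x | enorm x <= 1]].

Definition qform n (A : 'M[R]_n) (x : 'cV[R]_n) : R := (x^T *m A *m x) 0 0.

Definition posdefmx n (A : 'M[R]_n) : Prop :=
  A^T = A /\ forall x, x != 0 -> 0 < qform A x.

Definition possemidefmx n (A : 'M[R]_n) : Prop :=
  A^T = A /\ forall x, 0 <= qform A x.

(* The principal square root: a positive semidefinite A has exactly one
   positive semidefinite square root, and [xget] selects it. *)
Definition sqrtmx n (A : 'M[R]_n) : 'M[R]_n :=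
  xget 0 [set B : 'M[R]_n | possemidefmx B /\ B *m B = A].

Definition invsqrtmx n (A : 'M[R]_n) : 'M[R]_n := invmx (sqrtmx A).

(* ||x||_P, with ||x||_P ^+ 2 = x^T P x *)
Definition pnorm n (P : 'M[R]_n) (x : 'cV[R]_n) : R := Num.sqrt (qform P x).

Definition grad n (F : 'cV[R]_n -> R) (x : 'cV[R]_n) : 'cV[R]_n :=
  \col_i 'D_(delta_mx i 0) F x.

Definition gauss_pdf n (mu : 'cV[R]_n) (Sigma : 'M[R]_n) (u : 'cV[R]_n) : R :=
  (Num.sqrt ((2 * pi) ^+ n * \det Sigma))^-1 *
  expR (- (qform (invmx Sigma) (u - mu)) / 2).

Local Notation leb n := (lebesgue_Rn n).

Definition pdf_mean n (rho : 'cV[R]_n -> R) : 'cV[R]_n :=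
  \col_i \int[leb n]_u (u i 0 * rho u).

Definition pdf_cov n (rho : 'cV[R]_n -> R) : 'M[R]_n :=
  \matrix_(i, j) \int[leb n]_u
    ((u i 0 - pdf_mean rho i 0) * (u j 0 - pdf_mean rho j 0) * rho u).

End linear_algebra.

Section relaxed_mppi.
Context {R : realType} {m : nat}.
Variables (C : set 'cV[R]_m) (f0 : 'cV[R]_m -> R) (tau : R) (Sigma : 'M[R]_m).

Definition mppi_Z (mu : 'cV[R]_m) : R :=
  \int[lebesgue_Rn m]_(u in C) (gauss_pdf mu Sigma u * expR (- f0 u / tau)).

Definition mppi_F (mu : 'cV[R]_m) : R := - tau * ln (mppi_Z mu).

Definition mppi_rho (mu u : 'cV[R]_m) : R :=
  gauss_pdf mu Sigma u * expR (- f0 u / tau) * \1_C u / mppi_Z mu.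

Definition mppi_D : R :=
  sup [set enorm (invsqrtmx Sigma *m (p.1 - p.2)) | p in C `*` C].

(* Extended-real valued: the real-valued [sup] of an unbounded set is 0. *)
Definition mppi_L : \bar R :=
  ereal_sup [set (spectral_norm (1%:M - invsqrtmx Sigma *m
    pdf_cov (mppi_rho mu) *m invsqrtmx Sigma))%:E | mu in [set: 'cV[R]_m]].

End relaxed_mppi.

(* Main.v *)
Require Import Defs.
From HB Require Import structures.
From mathcomp Require Import all_boot all_order all_algebra.
From mathcomp Require Import all_classical all_reals all_analysis.
From mathcomp Require Import ring lra.

Import Order.TTheory GRing.Theory Num.Theory.
Import numFieldNormedType.Exports.

Local Open Scope classical_set_scope.
Local Open Scope ring_scope.

(** The objective [F] is smooth in the metric of [Sigma^-1] with the very
    constant [L], and the update is a gradient step in that metric, so that the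
    claims are those of gradient descent on a function bounded below.

    Along a line [mu + t d], completing the square in the Gaussian turns the
    partition function into [exp (- t^2 a / 2)] times the partition function of
    an exponential family over [C] with statistic
    [b u = d^T Sigma^-1 (u - mu)], where [a = d^T Sigma^-1 d]
    ([mppi_weight_line]).  Differentiating under the integral
    ([is_derive_integral_tilt]), the derivatives of the logarithm of that
    partition function are the mean and the variance of [b].  Therefore
    [grad F mu = tau Sigma^-1 (mu - E u)] ([mppi_gradE]), and the second
    derivative of [F] along [d] is
    [tau y^T (1 - W Cov W) y] with [W = Sigma^(-1/2)] and [y = W d]
    ([is_derive2_mppi_F_line]).

    The bound on [L]: the variance of the linear form [y^T W u] is nonnegative
    and, its range over [C] being at most [|y| D], Popoviciu's inequality bounds
    it by [|y|^2 D^2 / 4] ([wvar_le]).  So the quadratic form of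
    [1 - W Cov W] lies between [(1 - D^2/4) |y|^2] and [|y|^2]
    ([mppi_hessian_le]), and a symmetric matrix has norm bounded by its
    quadratic form ([sym_form_le]).

    The descent: as the second derivative is at most [tau L d^T Sigma^-1 d],
    [F] is below its quadratic upper model ([mppi_F_smooth]); at the update the
    latter is [F mu - eta (1 - eta L / 2) |grad F mu|_P^2] ([mppi_descent]).
    Telescoping over the iterations gives the bounds on the sum and on the
    minimum ([descent_partial_sum]), and the terms of a convergent series tend
    to zero.

    Two foundations support this.  [W] makes sense because a positive
    semidefinite matrix has a positive semidefinite square root, obtained by
    splitting off eigenvectors that maximise the Rayleigh quotient
    ([psd_sqrt_exists]).  Continuous functions are integrable over [C] because
    open sets belong to the product sigma-algebra ([open_measurable_colvec]) and
    compact sets have finite measure ([compact_finite_lebesgue_Rn]). *)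

Set Implicit Arguments.
Unset Strict Implicit.
Unset Printing Implicit Defensive.

(** * Bilinear forms and the Euclidean norm *)

Definition bform {R : realType} n (A : 'M[R]_n) (x y : 'cV[R]_n) : R :=
  (x^T *m A *m y) 0 0.

Section bilinear_forms.
Context {R : realType} {n : nat}.
Implicit Types (A B : 'M[R]_n) (x y z : 'cV[R]_n).

Lemma qformE A x : qform A x = bform A x x. Proof. by []. Qed.

Lemma bformE A x y : bform A x y = \sum_i \sum_j x i 0 * A i j * y j 0.
Proof.
rewrite /bform -mulmxA mxE; apply: eq_bigr => i _.
by rewrite !mxE mulr_sumr; apply: eq_bigr => j _; rewrite mulrA.
Qed.

Lemma bform1E x y : bform 1%:M x y = \sum_i x i 0 * y i 0.
Proof. by rewrite /bform mulmx1 mxE; apply: eq_bigr => i _; rewrite mxE. Qed.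

Lemma bformDl A x y z : bform A (x + y) z = bform A x z + bform A y z.
Proof. by rewrite /bform linearD /= !mulmxDl mxE. Qed.

Lemma bformDr A x y z : bform A x (y + z) = bform A x y + bform A x z.
Proof. by rewrite /bform mulmxDr mxE. Qed.

Lemma bformZl A a x y : bform A (a *: x) y = a * bform A x y.
Proof. by rewrite /bform linearZ /= -!scalemxAl mxE. Qed.

Lemma bformZr A a x y : bform A x (a *: y) = a * bform A x y.
Proof. by rewrite /bform -scalemxAr mxE. Qed.

Lemma bformNl A x y : bform A (- x) y = - bform A x y.
Proof. by rewrite -scaleN1r bformZl mulN1r. Qed.

Lemma bformNr A x y : bform A x (- y) = - bform A x y.
Proof. by rewrite -scaleN1r bformZr mulN1r. Qed.

Lemma bform0l A y : bform A 0 y = 0.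
Proof. by rewrite -(scale0r 0) bformZl mul0r. Qed.

Lemma bformD_mx A B x y : bform (A + B) x y = bform A x y + bform B x y.
Proof. by rewrite /bform mulmxDr mulmxDl mxE. Qed.

Lemma bformN_mx A x y : bform (- A) x y = - bform A x y.
Proof. by rewrite /bform mulmxN mulNmx mxE. Qed.

Lemma bformZ_mx a A x y : bform (a *: A) x y = a * bform A x y.
Proof. by rewrite /bform -scalemxAr -scalemxAl mxE. Qed.

Lemma bformMr A B x y : bform A x (B *m y) = bform (A *m B) x y.
Proof. by rewrite /bform !mulmxA. Qed.

Lemma bformMl A B x y : bform A (B *m x) y = bform (B^T *m A) x y.
Proof. by rewrite /bform trmx_mul !mulmxA. Qed.

Lemma bform_sym A x y : A^T = A -> bform A x y = bform A y x.
Proof.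
move=> As; rewrite /bform -[in LHS]As.
suff -> : x^T *m A^T *m y = (y^T *m A *m x)^T by rewrite mxE.
by rewrite !trmx_mul trmxK mulmxA.
Qed.

Lemma bform_delta A i y : bform A (delta_mx i 0) y = (A *m y) i 0.
Proof. by rewrite /bform -mulmxA trmx_delta -rowE mxE. Qed.

Lemma qformD A x y : A^T = A ->
  qform A (x + y) = qform A x + bform A x y *+ 2 + qform A y.
Proof.
move=> As; rewrite !qformE bformDl !bformDr (bform_sym y x As) mulr2n; ring.
Qed.

Lemma qformZ A a x : qform A (a *: x) = a ^+ 2 * qform A x.
Proof. by rewrite !qformE bformZl bformZr mulrA expr2. Qed.

Lemma qformB A x y : A^T = A ->
  qform A (x - y) = qform A x - bform A x y *+ 2 + qform A y.
Proof.
by move=> As; rewrite qformD// bformNr mulNrn !qformE bformNl bformNr opprK.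
Qed.

Lemma posdef_psd A : posdefmx A -> possemidefmx A.
Proof.
move=> [As Ap]; split=> // x; have [->|/Ap/ltW//] := eqVneq x 0.
by rewrite qformE bform0l.
Qed.

(** Cauchy-Schwarz for a positive semidefinite form. When [y] is isotropic,
    [q (x + s y)] is affine in [s], and a nonnegative affine function is
    constant. *)
Lemma psd_cauchy_schwarz A x y : possemidefmx A ->
  bform A x y ^+ 2 <= qform A x * qform A y.
Proof.
move=> [As Ap]; set b := bform A x y.
have H s : 0 <= qform A x + (s * b) *+ 2 + s ^+ 2 * qform A y.
  by rewrite -qformZ /b -bformZr -qformD.
have [c0|c0] := eqVneq (qform A y) 0.
  have [->|b0] := eqVneq b 0; first by rewrite expr0n c0 mulr0.
  (* The affine function takes the value -1 at this point. *)
  have := H (- (qform A x + 1) / (2 * b)).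
  suff -> : qform A x + (- (qform A x + 1) / (2 * b) * b) *+ 2 +
    (- (qform A x + 1) / (2 * b)) ^+ 2 * qform A y = -1.
    by rewrite leNgt ltrN10.
  by rewrite c0; field.
have cp : 0 < qform A y by rewrite lt_def c0 Ap.
(* The quadratic polynomial in [s] is minimal at this point. *)
have := H (- b / qform A y).
suff -> : qform A x + (- b / qform A y * b) *+ 2 +
    (- b / qform A y) ^+ 2 * qform A y = qform A x - b ^+ 2 / qform A y.
  by rewrite subr_ge0 ler_pdivrMr.
by field.
Qed.

(** By Cauchy-Schwarz, an isotropic vector is orthogonal to every vector. *)
Lemma psd_isotropic A x : possemidefmx A -> qform A x = 0 -> A *m x = 0.
Proof.
move=> Ap qx; apply/colP => i; rewrite -bform_delta !mxE; apply/eqP.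
rewrite -sqrf_eq0 eq_le sqr_ge0 andbT.
by rewrite (le_trans (psd_cauchy_schwarz _ _ Ap))// qx mulr0.
Qed.

End bilinear_forms.

Section euclidean_norm.
Context {R : realType} {n : nat}.
Implicit Types (A B : 'M[R]_n) (x y z : 'cV[R]_n).

Lemma psd_1 : possemidefmx (1%:M : 'M[R]_n).
Proof.
split=> [|x]; first by rewrite trmx1.
by rewrite qformE bform1E sumr_ge0// => i _; rewrite -expr2 sqr_ge0.
Qed.

Lemma enorm_sqr x : enorm x ^+ 2 = qform 1%:M x.
Proof.
rewrite sqr_sqrtr; last by rewrite sumr_ge0// => i _; rewrite sqr_ge0.
by rewrite qformE bform1E; apply: eq_bigr => i _; rewrite expr2.
Qed.

Lemma enorm_ge0 x : 0 <= enorm x. Proof. exact: sqrtr_ge0. Qed.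

Lemma enorm_eq0 x : (enorm x == 0) = (x == 0).
Proof.
apply/idP/eqP => [/eqP e0|->]; last first.
  by rewrite -sqrf_eq0 enorm_sqr qformE bform0l.
rewrite -[x]mul1mx; apply: psd_isotropic psd_1 _.
by rewrite -enorm_sqr e0 expr0n.
Qed.

Lemma enorm0 : enorm (0 : 'cV[R]_n) = 0.
Proof. by apply/eqP; rewrite enorm_eq0. Qed.

Lemma enorm_gt0 x : (0 < enorm x) = (x != 0).
Proof. by rewrite lt_def enorm_eq0 enorm_ge0 andbT. Qed.

Lemma enormZ a x : enorm (a *: x) = `|a| * enorm x.
Proof.
apply/eqP; rewrite -(@eqrXn2 _ 2) ?mulr_ge0 ?enorm_ge0//.
by rewrite exprMn !enorm_sqr qformZ real_normK ?num_real.
Qed.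

Lemma cauchy_schwarz x y : `|bform 1%:M x y| <= enorm x * enorm y.
Proof.
rewrite -(@ler_pXn2r _ 2) ?nnegrE ?mulr_ge0 ?enorm_ge0//.
rewrite real_normK ?num_real// exprMn !enorm_sqr.
exact: psd_cauchy_schwarz psd_1.
Qed.

(** By polarisation: with [y] the vector [A x] rescaled to the length of [x],
    [4 y^T A x] is the difference of the quadratic form at [x + y] and at
    [x - y], whose squared lengths add up to [4 |x|^2]. *)
Lemma sym_form_le A c x : A^T = A ->
  (forall y, `|qform A y| <= c * enorm y ^+ 2) -> enorm (A *m x) <= c * enorm x.
Proof.
move=> As Ac; have [->|Ax0] := eqVneq (A *m x) 0.
  rewrite enorm0; have [->|x0] := eqVneq x 0; first by rewrite enorm0 mulr0.
  have ex : 0 < enorm x by rewrite enorm_gt0.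
  by rewrite -(pmulr_lge0 _ ex) -mulrA -expr2 (le_trans _ (Ac x)).
have a0 : 0 < enorm (A *m x) by rewrite enorm_gt0.
have x0 : 0 < enorm x.
  by rewrite enorm_gt0; apply: contra Ax0 => /eqP ->; rewrite mulmx0.
pose y := (enorm x / enorm (A *m x)) *: (A *m x).
have ey : enorm y = enorm x.
  by rewrite enormZ ger0_norm ?divr_ge0 ?enorm_ge0// divfK// lt0r_neq0.
have byx : bform A x y = enorm x * enorm (A *m x).
  rewrite bformZr bform_sym// bformE.
  have -> : \sum_i \sum_j (A *m x) i 0 * A i j * x j 0 = enorm (A *m x) ^+ 2.
    rewrite enorm_sqr qformE bform1E; apply: eq_bigr => i _.
    by rewrite [in RHS]mxE mulr_sumr; apply: eq_bigr => j _; rewrite mxE mulrA.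
  by field; rewrite lt0r_neq0.
move: y ey byx => y ey byx.
have par : enorm (x + y) ^+ 2 + enorm (x - y) ^+ 2 = 4 * enorm x ^+ 2.
  rewrite !enorm_sqr qformB ?qformD ?trmx1//.
  by rewrite -!enorm_sqr ey; ring.
have pol : qform A (x + y) - qform A (x - y) = 4 * bform A x y.
  by rewrite qformD// qformB//; ring.
have /ler_normlP[_ h1] := Ac (x + y).
have /ler_normlP[h2 _] := Ac (x - y).
rewrite -(ler_pM2l x0) -byx -(@ler_pM2l _ 4)// -pol.
apply: le_trans (lerD h1 h2) _.
by rewrite -mulrDr par le_eqVlt; apply/orP; left; apply/eqP; ring.
Qed.

End euclidean_norm.

(** * Continuity of forms, the spectral norm *)

Section continuity_of_forms.
Context {R : realType} {T : topologicalType}.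

Lemma continuous_bigsum (I : Type) (r : seq I) (f : I -> T -> R) :
  (forall i, continuous (f i)) -> continuous (fun t => \sum_(i <- r) f i t).
Proof.
move=> cf t; elim: r => [|i r IHr].
  by under eq_fun do rewrite big_nil; exact: cvg_cst.
by under eq_fun do rewrite big_cons; apply: cvgD; [exact: cf|exact: IHr].
Qed.

Lemma continuous_bform n (A : 'M[R]_n) (f g : T -> 'cV[R]_n) :
  (forall i, continuous (fun t => f t i 0)) ->
  (forall i, continuous (fun t => g t i 0)) ->
  continuous (fun t => bform A (f t) (g t)).
Proof.
move=> cf cg; under eq_fun do rewrite bformE.
apply: continuous_bigsum => i; apply: continuous_bigsum => j t.
by apply: cvgM (cg j t); apply: cvgM (cf i t) _; exact: cvg_cst.
Qed.

End continuity_of_forms.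

Section spectral_norm_theory.
Context {R : realType} {n : nat}.
Implicit Types (A B : 'M[R]_n) (x y z : 'cV[R]_n).

Lemma spectral_norm_le A c : 0 <= c ->
  (forall x, enorm (A *m x) <= c * enorm x) -> spectral_norm A <= c.
Proof.
move=> c0 Ac; apply: ge_sup => [|_ [x /= x1 <-]].
  by exists (enorm (A *m 0)), 0 => //=; rewrite enorm0.
by rewrite (le_trans (Ac x))// -[leRHS]mulr1 ler_wpM2l.
Qed.

(** The set whose supremum is the norm is bounded: by Cauchy-Schwarz on each row,
    the Frobenius norm is an upper bound. *)
Lemma le_spectral_norm A x : enorm (A *m x) <= spectral_norm A * enorm x.
Proof.
have [->|x0] := eqVneq x 0; first by rewrite mulmx0 !enorm0 mulr0.
have ex : 0 < enorm x by rewrite enorm_gt0.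
pose M := Num.sqrt (\sum_i enorm (row i A)^T ^+ 2).
have AM y : enorm (A *m y) <= M * enorm y.
  rewrite -(@ler_pXn2r _ 2) ?nnegrE ?mulr_ge0 ?enorm_ge0 ?sqrtr_ge0//.
  rewrite exprMn !sqr_sqrtr; do ?by apply: sumr_ge0 => i _; exact: sqr_ge0.
  rewrite mulr_suml; apply: ler_sum => i _.
  have -> : (A *m y) i 0 = bform 1%:M (row i A)^T y.
    by rewrite bform1E mxE; apply: eq_bigr => j _; rewrite !mxE.
  rewrite -real_normK ?num_real// -[X in _ * X]sqr_sqrtr; last first.
    by apply: sumr_ge0 => j _; exact: sqr_ge0.
  by rewrite -exprMn lerXn2r ?nnegrE ?mulr_ge0 ?enorm_ge0 ?cauchy_schwarz.
rewrite -ler_pdivrMr//; apply: sup_ubound.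
  exists M => _ [y /= y1 <-]; rewrite (le_trans (AM y))//.
  by rewrite -[leRHS]mulr1 ler_wpM2l ?sqrtr_ge0.
exists ((enorm x)^-1 *: x) => /=.
  by rewrite enormZ ger0_norm ?invr_ge0 ?enorm_ge0// mulVf// gt_eqF.
by rewrite -scalemxAr enormZ ger0_norm ?invr_ge0 ?enorm_ge0// mulrC.
Qed.

Lemma qform_le_spectral_norm A x :
  qform A x <= spectral_norm A * enorm x ^+ 2.
Proof.
rewrite qformE -[A]mul1mx -bformMr mul1mx (le_trans (ler_norm _))//.
rewrite (le_trans (cauchy_schwarz _ _))// mulrC expr2 mulrA.
by rewrite ler_wpM2r ?enorm_ge0// le_spectral_norm.
Qed.

End spectral_norm_theory.

(** * Square roots of positive semidefinite matrices *)

Section principal_square_root.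
Context {R : realType} {n : nat}.
Implicit Types (A B : 'M[R]_n) (x y z : 'cV[R]_n).

(** The Rayleigh quotient attains its maximum [l] on the unit sphere, and a
    maximiser is an eigenvector because it is isotropic for the positive
    semidefinite form [l - A]. *)
Lemma top_eigenvector A x0 : x0 != 0 -> A^T = A ->
  exists v l, [/\ enorm v = 1, A *m v = l *: v &
    forall x, qform A x <= l * enorm x ^+ 2].
Proof.
move=> x0n As; pose S : set 'rV[R]_n := [set x | qform 1%:M x^T = 1].
have cq (B : 'M[R]_n) : continuous (fun x : 'rV[R]_n => qform B x^T).
  by apply: continuous_bform => i; under eq_fun do rewrite mxE;
    exact: coord_continuous.
have ex0 : 0 < enorm x0 by rewrite enorm_gt0.
have S0 : S !=set0.
  exists ((enorm x0)^-1 *: x0)^T; rewrite /S /= trmxK -enorm_sqr enormZ.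
  by rewrite ger0_norm ?invr_ge0 ?enorm_ge0// mulVf ?gt_eqF// expr1n.
have Sc : compact S.
  apply: bounded_closed_compact.
    exists 1; split=> // M M1 x; rewrite /S /= => qx1.
    rewrite [leLHS]mx_normrE; apply/bigmax_leP; split=> [|[i j] _ /=].
      by rewrite ltW// (lt_trans ltr01).
    apply: le_trans (ltW M1).
    rewrite -(@ler_pXn2r _ 2) ?nnegrE// real_normK ?num_real// expr1n -qx1.
    rewrite qformE bform1E (bigD1 j)//= !mxE (ord1 i) -expr2 lerDl.
    by apply: sumr_ge0 => k _; rewrite -expr2 sqr_ge0.
  have -> : S = (fun x : 'rV[R]_n => qform 1%:M x^T) @^-1` [set 1] by [].
  by apply: preimage_closed => [x _|]; [exact: cq|exact: closed_eq].
have [w /[!inE] Sw maxw] := EVT_max_rV S0 Sc (continuous_subspaceT (cq A)).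
have q1 : qform 1%:M w^T = 1 := Sw.
exists w^T, (qform A w^T).
have maxq x : qform A x <= qform A w^T * enorm x ^+ 2.
  have [->|xn] := eqVneq x 0.
    by rewrite qformE bform0l enorm0 expr0n mulr0.
  have ex : 0 < enorm x by rewrite enorm_gt0.
  have := maxw ((enorm x)^-1 *: x)^T; rewrite inE /S /= trmxK -enorm_sqr enormZ.
  rewrite ger0_norm ?invr_ge0 ?enorm_ge0// mulVf ?gt_eqF// expr1n => /(_ erefl).
  by rewrite qformZ exprVn mulrC ler_pdivrMr// exprn_gt0.
split=> //.
  by apply/eqP; rewrite -(@eqrXn2 _ 2) ?enorm_ge0// enorm_sqr q1 expr1n.
have Bpsd : possemidefmx (qform A w^T *: 1%:M - A).
  split=> [|x]; first by rewrite linearB /= linearZ /= trmx1 As.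
  by rewrite qformE bformD_mx bformN_mx bformZ_mx -!qformE -enorm_sqr subr_ge0.
have := psd_isotropic (x := w^T) Bpsd.
rewrite qformE bformD_mx bformN_mx bformZ_mx -!qformE q1 mulr1 subrr.
move=> /(_ erefl).
by rewrite mulmxBl -scalemxAl mul1mx => /eqP; rewrite subr_eq0 => /eqP.
Qed.

(** Induction on the rank: removing from [A] the component [l v v^T] along a
    top eigenvector [v] leaves a positive semidefinite matrix of smaller rank
    that kills [v]; its square root also kills [v], so adding
    [sqrt l v v^T] to it gives a square root of [A]. *)
Lemma psd_sqrt_exists A : possemidefmx A ->
  exists B, possemidefmx B /\ B *m B = A.
Proof.
have [r] := ubnP (\rank A); elim: r A => // r IHr A rA [As Ap].
have [->|A0] := eqVneq A 0.
  exists 0; rewrite mulmx0; split=> //; split; first by rewrite trmx0.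
  by move=> x; rewrite /qform mulmx0 mul0mx mxE.
have [x0 Ax0] : exists x0, A *m x0 != 0.
  apply: contrapT => /forallNP nA; move/eqP: A0; apply.
  apply/matrixP => i j; have /negP/negPn/eqP := nA (delta_mx j 0).
  by rewrite -colE => /colP/(_ i); rewrite !mxE.
have x0n : x0 != 0 by apply: contra Ax0 => /eqP ->; rewrite mulmx0.
have [v [l [v1 Av lmax]]] := top_eigenvector x0n As.
have vv : v^T *m v = 1%:M.
  apply/matrixP => i j; rewrite (ord1 i) (ord1 j) [RHS]mxE eqxx mulr1n.
  by rewrite -[in LHS](mulmx1 v^T) -/(bform _ _ _) -qformE -enorm_sqr v1 expr1n.
have l0 : 0 < l.
  rewrite ltNge; apply/negP => l0; move/eqP: Ax0; apply.
  apply: psd_isotropic => //; apply/le_anti; rewrite Ap andbT.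
  by rewrite (le_trans (lmax _))// mulr_le0_ge0// sqr_ge0.
have vA : v^T *m A = l *: v^T by rewrite -[A]As -trmx_mul Av linearZ.
pose E := v *m v^T; pose A' := A - l *: E.
have Es : E^T = E by rewrite trmx_mul trmxK.
have EE : E *m E = E by rewrite /E mulmxA -(mulmxA v) vv mulmx1.
have EA : E *m A = l *: E by rewrite /E -mulmxA vA -scalemxAr.
have AE : A *m E = l *: E by rewrite /E mulmxA Av -scalemxAl.
have A'v : A' *m v = 0.
  by rewrite mulmxBl Av -scalemxAl /E -mulmxA vv mulmx1 subrr.
have A'E : A' *m E = 0 by rewrite mulmxA A'v mul0mx.
(* [A'] is the compression of [A] to the orthogonal complement of [v]. *)
have A'A : A' = (1%:M - E)^T *m A *m (1%:M - E).
  have -> : (1%:M - E)^T = 1%:M - E by rewrite linearB /= trmx1 Es.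
  rewrite mulmxBl mul1mx EA mulmxBr mulmx1 mulmxBl AE.
  by rewrite -scalemxAl EE subrr subr0.
have A'psd : possemidefmx A'.
  split; first by rewrite A'A !trmx_mul trmxK As mulmxA.
  by move=> x; rewrite A'A qformE -bformMr -bformMl -qformE Ap.
have rA' : (\rank A' < r)%N.
  rewrite -ltnS (leq_trans _ rA)// ltnS; apply: rank_ltmx; rewrite ltmxE.
  apply/andP; split.
    have -> : A' = (1%:M - E) *m A by rewrite mulmxBl mul1mx EA.
    exact: submxMl.
  apply/negP => /submxP[D AD]; move: Av; rewrite AD -mulmxA A'v mulmx0.
  move=> /esym/eqP; rewrite scaler_eq0 gt_eqF//= => /eqP v0.
  by move: v1 => /eqP; rewrite v0 enorm0 eq_sym oner_eq0.
have [B [Bp BB]] := IHr _ rA' A'psd; have [Bs Bge] := Bp.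
have Bv : B *m v = 0.
  apply/eqP; rewrite -enorm_eq0 -sqrf_eq0 enorm_sqr qformE bformMr bformMl.
  by rewrite mul1mx Bs BB /bform -mulmxA A'v mulmx0 mxE.
have BE : B *m E = 0 by rewrite mulmxA Bv mul0mx.
have EB : E *m B = 0 by rewrite -Es -Bs -trmx_mul BE trmx0.
exists (B + Num.sqrt l *: E); split.
  split=> [|x]; first by rewrite linearD /= linearZ /= Bs Es.
  rewrite qformE bformD_mx bformZ_mx addr_ge0 ?mulr_ge0 ?sqrtr_ge0 ?Bge//.
  have -> : E = E^T *m (1%:M *m E) by rewrite Es mul1mx EE.
  by rewrite -bformMl -bformMr; exact: psd_1.2.
rewrite mulmxDl !mulmxDr -!scalemxAl -!scalemxAr BE EB EE BB.
rewrite !scaler0 addr0 add0r.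
by rewrite scalerA -expr2 sqr_sqrtr ?ltW// subrK.
Qed.

End principal_square_root.

Section principal_square_root_inverse.
Context {R : realType} {n : nat}.
Variable Sigma : 'M[R]_n.
Hypothesis Sigma_posdef : posdefmx Sigma.

Lemma sqrtmx_psd : possemidefmx (sqrtmx Sigma).
Proof.
by have [] := xgetPex 0 (psd_sqrt_exists (posdef_psd Sigma_posdef)).
Qed.

Lemma sqrtmxK : sqrtmx Sigma *m sqrtmx Sigma = Sigma.
Proof.
by have [] := xgetPex 0 (psd_sqrt_exists (posdef_psd Sigma_posdef)).
Qed.

Lemma posdef_unitmx : Sigma \in unitmx.
Proof.
rewrite -row_free_unit -kermx_eq0; apply/negPn/negP.
move=> /rowV0Pn[v /sub_kermxP vS v0].
have /(Sigma_posdef.2) : v^T != 0 by rewrite -trmx0 (inj_eq trmx_inj).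
by rewrite /qform trmxK vS mul0mx mxE ltxx.
Qed.

Lemma sqrtmx_unitmx : sqrtmx Sigma \in unitmx.
Proof.
by have := posdef_unitmx; rewrite -[X in X \in _]sqrtmxK unitmx_mul andbb.
Qed.

Lemma posdef_det_gt0 : 0 < \det Sigma.
Proof.
have := sqrtmx_unitmx; rewrite unitmxE unitfE => d0.
by rewrite -sqrtmxK det_mulmx -expr2 lt_def sqr_ge0 sqrf_eq0 d0.
Qed.

Lemma invsqrtmx_sym : (invsqrtmx Sigma)^T = invsqrtmx Sigma.
Proof. by rewrite /invsqrtmx trmx_inv sqrtmx_psd.1. Qed.

Lemma invsqrtmxK : invsqrtmx Sigma *m invsqrtmx Sigma = invmx Sigma.
Proof.
rewrite -[LHS](mulmxK posdef_unitmx) -[X in _ *m X *m _]sqrtmxK.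
rewrite /invsqrtmx !mulmxA mulmxKV ?sqrtmx_unitmx// mulVmx ?sqrtmx_unitmx//.
by rewrite mul1mx.
Qed.

Lemma invmx_posdef_sym : (invmx Sigma)^T = invmx Sigma.
Proof. by rewrite trmx_inv Sigma_posdef.1. Qed.

(** The Mahalanobis form is the Euclidean form in whitened coordinates. *)
Lemma bform_invmxE x y :
  bform (invmx Sigma) x y =
  bform 1%:M (invsqrtmx Sigma *m x) (invsqrtmx Sigma *m y).
Proof.
by rewrite bformMl bformMr invsqrtmx_sym mulmx1 invsqrtmxK.
Qed.

End principal_square_root_inverse.

(** * Topology and measure on column vectors *)

Section borel_sets.
Context {R : realType} {n : nat}.

Lemma measurable_colvec_box (A : 'I_n -> set (measurableTypeR R)) :
  (forall i, measurable (A i)) ->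
  measurable [set v : 'cV[R]_n | forall i, A i (v i 0)].
Proof.
move=> mA; rewrite (_ : mkset _ = \bigcap_(i in [set: 'I_n])
    ((fun v : 'cV[R]_n => v i 0 : measurableTypeR R) @^-1` A i)).
  apply: fin_bigcap_measurable => [|i _]; first exact: finite_finset.
  by rewrite -[X in measurable X]setTI; exact: measurable_coord.
by apply/seteqP; split => [v Av i _|v Av i]; [exact: Av|exact: Av].
Qed.

(** An open set is the union of the countably many boxes with rational centre
    and radius [1/(k+1)] that it contains. *)
Lemma open_measurable_colvec (U : set 'cV[R]_n) : open U -> measurable U.
Proof.
move=> oU.
pose box (p : 'cV[rat]_n * nat) : set 'cV[R]_n := [set v | forall i,
  [set x : R | `|x - ratr (p.1 i 0)| < p.2.+1%:R^-1] (v i 0)].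
have mbox p : measurable (box p).
  apply: (@measurable_colvec_box (fun i =>
    [set x : R | `|x - ratr (p.1 i 0)| < p.2.+1%:R^-1])) => i.
  apply: measurable_realfun.open_measurable.
  rewrite (_ : mkset _ = `](ratr (p.1 i 0) - p.2.+1%:R^-1),
                           (ratr (p.1 i 0) + p.2.+1%:R^-1)[%classic).
    exact: interval_open.
  by apply/seteqP; split => x /=; rewrite in_itv /= ltr_distl.
have -> : U = \bigcup_p (if `[< box p `<=` U >] then box p else set0).
  apply/seteqP; split => [x Ux|x [p _]]; last by case: asboolP => // bU /bU.
  have /nbhs_ballP[e /= e0 eU] : nbhs x U by exact: open_nbhs_nbhs.
  have [k ke] : exists k : nat, k.+1%:R^-1 < e / 2.
    have e2 : 0 < e / 2 by rewrite divr_gt0.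
    have [k _ /(_ k (leqnn _)) ke] := near_infty_natSinv_lt (PosNum e2).
    by exists k.
  have /choice[q hq] : forall i, exists q : rat, `|x i 0 - ratr q| < k.+1%:R^-1.
    move=> i.
    have [|q] := @rat_in_itvoo _ (x i 0 - k.+1%:R^-1) (x i 0 + k.+1%:R^-1).
      by rewrite ltrBlDr -addrA ltrDl addr_gt0// invr_gt0.
    by rewrite in_itv /= => xq; exists q; rewrite distrC ltr_distl.
  exists (\col_i q i, k) => //.
  case: asboolP => [_ i /=|[] v bv]; first by rewrite mxE.
  apply: eU; split=> // i j.
  rewrite (ord1 j) /ball /=; have := bv i; rewrite /= mxE => vi.
  have -> : x i 0 - v i 0 = (x i 0 - ratr (q i)) - (v i 0 - ratr (q i)).
    by ring.
  rewrite (le_lt_trans (ler_normB _ _))// [e]splitr ltrD//.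
    by rewrite (lt_trans (hq i)).
  by rewrite (lt_trans vi).
apply: countable_bigcupT_measurable => [|p]; first exact: countableP.
by case: asboolP.
Qed.

Lemma continuous_measurable_colvec (D : set 'cV[R]_n) (f : 'cV[R]_n -> R) :
  measurable D -> continuous f -> measurable_fun D f.
Proof.
move=> mD /continuousP cf.
apply: (measurability _ (measurable_realfun.RGenOpens.measurableE R)).
move=> _ [_ [a [b ->] <-]]; apply: measurableI => //.
by apply: open_measurable_colvec; exact/cf/interval_open.
Qed.

Lemma compact_measurable_colvec (C : set 'cV[R]_n) : compact C -> measurable C.
Proof.
move=> /(compact_closed (@norm_hausdorff _ _))/closed_openC.
by move=> /open_measurable_colvec/measurableC; rewrite setCK.
Qed.

(** A compact set lies in a cube, whose measure is a finite product of lengths. *)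
Lemma compact_finite_lebesgue_Rn (C : set 'cV[R]_n) :
  compact C -> (lebesgue_Rn n C < +oo)%E.
Proof.
move=> cC; have [M [Mr MC]] := compact_bounded cC.
pose J : set (measurableTypeR R) := `[- (M + 1), M + 1]%classic.
have mJ : measurable J by exact: measurable_itv.
pose B : set 'cV[R]_n := [set v | forall i, J (v i 0)].
have mB : measurable B by apply: (@measurable_colvec_box (fun=> J)) => i.
have CB : C `<=` B.
  move=> v /(MC (M + 1)) vM i; rewrite /J /= in_itv /= -ler_norml.
  apply: le_trans (vM _); last by rewrite ltrDl.
  rewrite [leRHS]mx_normrE.
  exact: (@le_bigmax _ _ _ 0 (fun ij => `|v ij.1 ij.2|) (i, 0)).
suff Boo : (lebesgue_Rn n B < +oo)%E.
  apply: le_lt_trans Boo; apply: le_measure; rewrite ?inE//.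
  exact: compact_measurable_colvec.
rewrite (_ : lebesgue_Rn n B = \prod_(i < n) lebesgue_measure J)%E; last first.
  exact: (@lebesgue_Rn_box _ _ (fun=> J)).
suff /fin_numPlt/andP[] : (\prod_(i < n) lebesgue_measure J)%E \is a fin_num.
  by [].
apply: prode_fin_num => i _.
by rewrite /J lebesgue_measure_itv /=; case: ifP.
Qed.

End borel_sets.

(** * Weighted means over a compact set *)

Section continuous_combinators.
Context {R : realType} {T : topologicalType}.
Implicit Types f g : T -> R.

Lemma continuous_mul f g : continuous f -> continuous g ->
  continuous (fun u => f u * g u).
Proof. by move=> cf cg u; apply: cvgM (cf u) (cg u). Qed.

Lemma continuous_add f g : continuous f -> continuous g ->
  continuous (fun u => f u + g u).
Proof. by move=> cf cg u; apply: cvgD (cf u) (cg u). Qed.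

Lemma continuous_sub f g : continuous f -> continuous g ->
  continuous (fun u => f u - g u).
Proof. by move=> cf cg u; apply: cvgB (cf u) (cg u). Qed.

Lemma continuous_opp f : continuous f -> continuous (fun u => - f u).
Proof. by move=> cf u; apply: cvgN; exact: cf. Qed.

Lemma continuous_const (a : R) : continuous (fun _ : T => a).
Proof. by move=> u; apply: cvg_cst. Qed.

Lemma continuous_exp f : continuous f -> continuous (fun u => expR (f u)).
Proof.
by move=> cf u; apply: continuous_comp (cf u) _; exact: continuous_expR.
Qed.

Lemma continuous_pow f k : continuous f -> continuous (fun u => f u ^+ k).
Proof.
move=> cf u.
apply: (@continuous_comp _ _ _ f (fun x => x ^+ k)); first exact: cf.
exact: exprn_continuous.
Qed.

Lemma continuous_abs f : continuous f -> continuous (fun u => `|f u|).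
Proof.
move=> cf u.
apply: (@continuous_comp _ _ _ f (fun x : R => `|x|)); first exact: cf.
exact: norm_continuous.
Qed.

End continuous_combinators.

Section weighted_mean.
Context {R : realType} {n : nat}.
Variable C : set 'cV[R]_n.
Hypotheses (C_nonempty : C !=set0) (C_compact : compact C).
Hypothesis C_pos : (0 < lebesgue_Rn n C)%E.
Implicit Types (h g p q : 'cV[R]_n -> R).

Local Notation Int h := (\int[lebesgue_Rn n]_(u in C) h u).

Lemma continuous_integrable h : continuous h ->
  (lebesgue_Rn n).-integrable C (EFin \o h).
Proof.
move=> ch; have mC := compact_measurable_colvec C_compact.
apply: measurable_bounded_integrable => //.
- exact: compact_finite_lebesgue_Rn.
- exact: continuous_measurable_colvec.
- have /compact_bounded[M [_ Mh]] :=
    continuous_compact (continuous_subspaceT ch) C_compact.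
  by exists M; split; rewrite ?num_real// => x Mx u Cu; apply: Mh.
Qed.

Lemma integralD_cont h g : continuous h -> continuous g ->
  Int (fun u => h u + g u) = Int h + Int g.
Proof.
move=> ch cg; apply: RintegralD; first exact: compact_measurable_colvec.
  exact: continuous_integrable.
exact: continuous_integrable.
Qed.

Lemma integralZ_cont a h : continuous h -> Int (fun u => a * h u) = a * Int h.
Proof.
move=> ch; apply: RintegralZl; first exact: compact_measurable_colvec.
exact: continuous_integrable.
Qed.

Lemma integral_sum_cont (I : Type) (r : seq I) (h : I -> 'cV[R]_n -> R) :
  (forall i, continuous (h i)) ->
  Int (fun u => \sum_(i <- r) h i u) = \sum_(i <- r) Int (h i).
Proof.
move=> ch; elim: r => [|i r IHr].
  rewrite big_nil; under eq_Rintegral do rewrite big_nil.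
  by rewrite Rintegral_cst ?mul0r//; exact: compact_measurable_colvec.
rewrite big_cons -IHr -integralD_cont//; last exact: continuous_bigsum.
by apply: eq_Rintegral => u _; rewrite big_cons.
Qed.

Lemma le_integral_cont h g : continuous h -> continuous g ->
  (forall u, C u -> h u <= g u) -> Int h <= Int g.
Proof.
move=> ch cg hg; apply: le_Rintegral => //.
- exact: compact_measurable_colvec.
- exact: continuous_integrable.
- exact: continuous_integrable.
Qed.

Lemma integral_cont_gt0 h : continuous h -> (forall u, C u -> 0 < h u) ->
  0 < Int h.
Proof.
move=> ch h0.
have [v /[!inE] Cv hv] :=
  compact_EVT_min C_nonempty C_compact (continuous_subspaceT ch).
have mC := compact_measurable_colvec C_compact.
apply: (@lt_le_trans _ _ (Int (fun=> h v))).
  rewrite Rintegral_cst// mulr_gt0 ?h0// fine_gt0// C_pos.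
  exact: compact_finite_lebesgue_Rn.
apply: le_integral_cont => //; first exact: continuous_const.
by move=> u Cu; apply: hv; rewrite inE.
Qed.

(** Normalising inside the mean makes it insensitive to the positive factors,
    such as [exp (- t^2 a / 2)], that appear when a Gaussian is translated. *)
Definition wmean p h : R := Int (fun u => h u * p u) / Int p.

Lemma wmeanZ_weight a q h : a != 0 -> continuous q ->
  continuous h -> wmean (fun u => a * q u) h = wmean q h.
Proof.
move=> a0 cq ch; rewrite /wmean integralZ_cont//.
have -> : Int (fun u => h u * (a * q u)) = a * Int (fun u => h u * q u).
  rewrite -integralZ_cont//; last exact: continuous_mul.
  by apply: eq_Rintegral => u _; ring.
by rewrite invfM mulrACA mulfV// mul1r.
Qed.

Variable p : 'cV[R]_n -> R.
Hypotheses (p_cont : continuous p) (p_gt0 : forall u, 0 < p u).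

Lemma weight_gt0 : 0 < Int p.
Proof. by apply: integral_cont_gt0. Qed.

Lemma wmeanD h g : continuous h -> continuous g ->
  wmean p (fun u => h u + g u) = wmean p h + wmean p g.
Proof.
move=> ch cg; rewrite /wmean -mulrDl; congr (_ / _).
rewrite -integralD_cont; try exact: continuous_mul.
by apply: eq_Rintegral => u _; rewrite mulrDl.
Qed.

Lemma wmeanZ a h : continuous h -> wmean p (fun u => a * h u) = a * wmean p h.
Proof.
move=> ch; rewrite /wmean mulrA; congr (_ / _).
rewrite -integralZ_cont; last exact: continuous_mul.
by apply: eq_Rintegral => u _; rewrite mulrA.
Qed.

Lemma wmean_sum (I : Type) (r : seq I) (h : I -> 'cV[R]_n -> R) :
  (forall i, continuous (h i)) ->
  wmean p (fun u => \sum_(i <- r) h i u) = \sum_(i <- r) wmean p (h i).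
Proof.
move=> ch; rewrite /wmean -mulr_suml; congr (_ / _).
rewrite -integral_sum_cont => [|i]; last exact: continuous_mul.
by apply: eq_Rintegral => u _; rewrite mulr_suml.
Qed.

Lemma wmean_cst a : wmean p (fun=> a) = a.
Proof.
rewrite /wmean integralZ_cont// mulfK//.
by rewrite gt_eqF// weight_gt0.
Qed.

Lemma le_wmean h g : continuous h -> continuous g ->
  (forall u, C u -> h u <= g u) -> wmean p h <= wmean p g.
Proof.
move=> ch cg hg; rewrite /wmean ler_pM2r ?invr_gt0 ?weight_gt0//.
apply: le_integral_cont; try exact: continuous_mul.
by move=> u Cu; rewrite ler_pM2r ?hg.
Qed.

Lemma eq_wmean h g : h =1 g -> wmean p h = wmean p g.
Proof. by move=> /funext ->. Qed.

Definition wvar h : R := wmean p (fun u => (h u - wmean p h) ^+ 2).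

Lemma wmean_sqrB h a : continuous h ->
  wmean p (fun u => (h u - a) ^+ 2) =
  wmean p (fun u => h u ^+ 2) - 2 * a * wmean p h + a ^+ 2.
Proof.
move=> ch; rewrite -[in RHS](wmean_cst (a ^+ 2)) -mulNr -wmeanZ//.
rewrite -wmeanD; [|exact: continuous_pow
  |by apply: continuous_mul => //; exact: continuous_const].
rewrite -wmeanD; [|by apply: continuous_add; [exact: continuous_pow|
  by apply: continuous_mul => //; exact: continuous_const]|exact: continuous_const].
by apply: eq_wmean => u; ring.
Qed.

Lemma wvarE h : continuous h ->
  wvar h = wmean p (fun u => h u ^+ 2) - wmean p h ^+ 2.
Proof. by move=> ch; rewrite /wvar wmean_sqrB//; ring. Qed.

Lemma wvar_ge0 h : continuous h -> 0 <= wvar h.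
Proof.
move=> ch; rewrite -(wmean_cst 0); apply: le_wmean; first exact: continuous_const.
  by apply: continuous_pow; apply: continuous_sub => //; exact: continuous_const.
by move=> u _; exact: sqr_ge0.
Qed.

(** Popoviciu's inequality: the variance is the least mean square deviation
    from a constant, here compared with the midpoint of the range. *)
Lemma wvar_le h d : continuous h ->
  (forall u v, C u -> C v -> h u - h v <= d) -> wvar h <= d ^+ 2 / 4.
Proof.
move=> ch hd.
have [M /[!inE] CM hM] :=
  compact_EVT_max C_nonempty C_compact (continuous_subspaceT ch).
have [m /[!inE] Cm hm] :=
  compact_EVT_min C_nonempty C_compact (continuous_subspaceT ch).
pose c := (h M + h m) / 2.
apply: (@le_trans _ _ (wmean p (fun u => (h u - c) ^+ 2))).
  by rewrite wvarE// wmean_sqrB//; have := sqr_ge0 (wmean p h - c); lra.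
rewrite -[leRHS]wmean_cst; apply: le_wmean.
- by apply: continuous_pow; apply: continuous_sub => //; exact: continuous_const.
- exact: continuous_const.
move=> u Cu; have uM := hM u (mem_set Cu); have um := hm u (mem_set Cu).
have Md := hd M m CM Cm.
have d0 : 0 <= d by rewrite (le_trans _ Md)// subr_ge0 hm// inE.
have -> : d ^+ 2 / 4 = (d / 2) ^+ 2 by field.
rewrite -[leLHS]real_normK ?num_real// lerXn2r ?nnegrE ?divr_ge0//.
rewrite /c ler_norml.
by apply/andP; split; lra.
Qed.

End weighted_mean.

(** * Exponential tilting *)

Section exponential_tilting.
Context {R : realType} {n : nat}.
Variable C : set 'cV[R]_n.
Hypotheses (C_nonempty : C !=set0) (C_compact : compact C).
Hypothesis C_pos : (0 < lebesgue_Rn n C)%E.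
Variables w b : 'cV[R]_n -> R.
Hypotheses (w_cont : continuous w) (w_gt0 : forall u, 0 < w u).
Hypothesis b_cont : continuous b.

Local Notation Int h := (\int[lebesgue_Rn n]_(u in C) h u).

(** The exponential family generated by the density [w] and the statistic [b];
    translating a Gaussian along a line is such a tilting. *)
Definition tilt (t : R) (u : 'cV[R]_n) : R := expR (t * b u) * w u.

Lemma tilt_cont t : continuous (tilt t).
Proof.
apply: continuous_mul => //; apply: continuous_exp.
by apply: continuous_mul => //; exact: continuous_const.
Qed.

Lemma tilt_gt0 t u : 0 < tilt t u.
Proof. by rewrite mulr_gt0 ?expR_gt0. Qed.

Lemma is_derive_tilt (u : 'cV[R]_n) (t : R) :
  is_derive t 1 (tilt ^~ u) (b u * tilt t u).
Proof.
have -> : tilt ^~ u = w u \*: (expR \o (b u \*: (@id R))).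
  by apply/funext => s; rewrite /tilt mulrC [s * _]mulrC.
have := is_deriveZ (w u) (is_derive1_comp (is_derive_expR (b u *: t))
  (is_deriveZ (b u) (is_derive_id t 1))).
move/is_derive_eq; apply.
have e (x y : R) : x *: y = x * y by [].
rewrite !e /tilt [t * _]mulrC. ring.
Qed.

(** Differentiation under the integral sign: on [C] the parameter derivative is
    dominated, for [|s - t| < 1], by a function that is continuous in [u] and
    hence integrable over the compact set [C]. *)
Lemma is_derive_integral_tilt (h : 'cV[R]_n -> R) (t : R) : continuous h ->
  is_derive t 1 (fun s => Int (fun u => h u * tilt s u))
    (Int (fun u => h u * b u * tilt t u)).
Proof.
move=> ch; pose f s u := h u * tilt s u.
have df (u : 'cV[R]_n) (s : R) : is_derive s 1 (f ^~ u) (h u * b u * tilt s u).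
  have -> : f ^~ u = h u \*: (tilt ^~ u) by [].
  by rewrite -mulrA; exact: (is_deriveZ (h u) (is_derive_tilt u s)).
have d1 s u : partial1of2 f s u = h u * b u * tilt s u.
  by rewrite partial1of2E; apply: derive_val.
(* For [|s - t| < 1], [|s b u| <= (|t| + 1) |b u|]. *)
pose G u := `|h u * b u * w u| * expR ((`|t| + 1) * `|b u|).
have cG : continuous G.
  apply: continuous_mul.
    by apply: continuous_abs; apply: continuous_mul => //; apply: continuous_mul.
  apply: continuous_exp; apply: continuous_mul; first exact: continuous_const.
  exact: continuous_abs.
have G0 u : 0 <= G u by rewrite mulr_ge0// expR_ge0.
have mC := compact_measurable_colvec C_compact.
have It : [set` `]t - 1, t + 1[] t by rewrite /= in_itv /= ltrDl gtrBl ltr01.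
have intf s : [set` `]t - 1, t + 1[] s ->
    (lebesgue_Rn n).-integrable C (EFin \o f s).
  move=> _; apply: continuous_integrable => //.
  by apply: continuous_mul => //; exact: tilt_cont.
have derf s u : [set` `]t - 1, t + 1[] s -> C u -> derivable (f ^~ u) s 1.
  by move=> _ _; apply: ex_derive.
have G_ub s u : [set` `]t - 1, t + 1[] s -> C u -> `|partial1of2 f s u| <= G u.
  rewrite /= in_itv /= => /andP[s1 s2] _; rewrite d1 /tilt /G.
  rewrite mulrA mulrAC normrM ler_wpM2l// ger0_norm ?expR_ge0// ler_expR.
  rewrite (le_trans (ler_norm _))// normrM ler_wpM2r//.
  have := ler_norm t; have := ler_norm (- t); rewrite normrN => ? ?.
  by rewrite ler_norml; apply/andP; split; lra.
have iG := continuous_integrable C_compact cG.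
apply: DeriveDef.
  exact: (@derivable_under_integral _ _ _ _ f C mC t (t - 1) (t + 1)
    It intf derf G G0 iG G_ub).
rewrite -derive1E.
rewrite (@differentiation_under_integral _ _ _ _ f C mC t (t - 1) (t + 1)
  It intf derf G G0 iG G_ub).
by apply: eq_Rintegral => u _; rewrite d1.
Qed.

Lemma partition_gt0 t : 0 < Int (tilt t).
Proof. by apply: weight_gt0 => //; [exact: tilt_cont|exact: tilt_gt0]. Qed.

Lemma is_derive_partition (t : R) :
  is_derive t 1 (fun s => Int (tilt s)) (Int (fun u => b u * tilt t u)).
Proof.
have := is_derive_integral_tilt t (@continuous_const R 'cV[R]_n 1).
have e1 s : Int (fun u => 1 * tilt s u) = Int (tilt s).
  by apply: eq_Rintegral => u _; rewrite mul1r.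
rewrite (_ : (fun s => Int (fun u => 1 * tilt s u)) = fun s => Int (tilt s)).
  move/is_derive_eq; apply.
  by apply: eq_Rintegral => u _; rewrite mul1r.
by apply/funext.
Qed.

Lemma is_derive_ln_partition (t : R) :
  is_derive t 1 (fun s => ln (Int (tilt s))) (wmean C (tilt t) b).
Proof.
have := is_derive1_comp (is_derive1_ln (partition_gt0 t)) (is_derive_partition t).
by move/is_derive_eq; apply; rewrite mulrC.
Qed.

(** The second derivative of the log-partition function is the variance of the
    statistic; this is where the covariance enters the Hessian of the objective. *)
Lemma is_derive_wmean_tilt (t : R) :
  is_derive t 1 (fun s => wmean C (tilt s) b) (wvar C (tilt t) b).
Proof.
have Z0 : Int (tilt t) != 0 by rewrite gt_eqF// partition_gt0.
have := is_deriveM (is_derive_integral_tilt t b_cont)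
  (is_deriveV Z0 (is_derive_partition t)).
move/is_derive_eq; apply.
rewrite wvarE//; [|exact: tilt_cont|exact: tilt_gt0].
have e (x y : R) : x *: y = x * y by [].
rewrite !e /wmean.
have -> : Int (fun u => b u ^+ 2 * tilt t u) = Int (fun u => b u * b u * tilt t u).
  by apply: eq_Rintegral => u _; rewrite expr2.
by field.
Qed.

End exponential_tilting.

(** * A quadratic upper bound on the line *)

Section second_order_taylor.
Context {R : realType}.

(** The mean value theorem is used twice: on [f'], and then on the difference
    between [f] and its quadratic upper model. *)
Lemma taylor2_le (f f' f'' : R -> R) K :
  (forall t : R, is_derive t 1 f (f' t)) ->
  (forall t : R, is_derive t 1 f' (f'' t)) ->
  (forall t, f'' t <= K) -> f 1 <= f 0 + f' 0 + K / 2.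
Proof.
move=> df df' f''K.
have cont (h h' : R -> R) (a b : R) : (forall t : R, is_derive t 1 h (h' t)) ->
    {within `[a, b], continuous h}.
  move=> dh; apply: derivable_within_continuous => t _.
  exact: (@ex_derive _ _ _ _ _ _ _ (dh t)).
have f'K t : 0 <= t -> f' t - f' 0 <= K * t.
  move=> t0.
  have [x _ ->] := MVT_segment t0 (fun x _ => df' x) (cont _ _ _ _ df').
  by rewrite subr0 ler_wpM2r.
pose h t := f t - f' 0 * t - K / 2 * t ^+ 2.
have dh (t : R) : is_derive t 1 h (f' t - f' 0 - K * t).
  have -> : h = f + ((- f' 0) \*: (@id R)) + ((- (K / 2)) \*: ((@id R) * (@id R))).
    by apply/funext => x; rewrite /h expr2 -!mulNr.
  apply: is_derive_eq (is_deriveD (is_deriveD (df t)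
    (is_deriveZ (- f' 0) (is_derive_id t 1)))
    (is_deriveZ (- (K / 2)) (is_deriveM (is_derive_id t 1) (is_derive_id t 1)))) _.
  have e (x y : R) : x *: y = x * y by [].
  by rewrite !e; field.
have [x x01] := MVT_segment ler01 (fun x _ => dh x) (cont _ _ _ _ dh).
move: x01; rewrite in_itv /= => /andP[x0 _].
have := f'K x x0; rewrite /h; lra.
Qed.

End second_order_taylor.

(** * Mean and covariance under the optimal density *)

Section mppi_expectations.
Context {R : realType} {m : nat}.
Variables (C : set 'cV[R]_m) (f0 : 'cV[R]_m -> R) (tau : R) (Sigma : 'M[R]_m).
Hypotheses (C_nonempty : C !=set0) (C_compact : compact C).
Hypothesis C_pos : (0 < lebesgue_Rn m C)%E.
Hypotheses (f0_cont : continuous f0) (tau_gt0 : 0 < tau).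
Hypothesis Sigma_posdef : posdefmx Sigma.

Local Notation Int h := (\int[lebesgue_Rn m]_(u in C) h u).
Local Notation Q := (invmx Sigma).
Local Notation W := (invsqrtmx Sigma).
Local Notation F := (mppi_F C f0 tau Sigma).
Local Notation rho := (mppi_rho C f0 tau Sigma).
Local Notation mean mu := (pdf_mean (rho mu)).

Definition mppi_weight (mu u : 'cV[R]_m) : R :=
  gauss_pdf mu Sigma u * expR (- f0 u / tau).

Lemma continuous_linear_form (A : 'M[R]_m) z :
  continuous (fun u : 'cV[R]_m => bform A z u).
Proof.
apply: continuous_bform => i; first exact: continuous_const.
exact: coord_continuous.
Qed.

Lemma mppi_weight_cont mu : continuous (mppi_weight mu).
Proof.
have cq : continuous (fun u : 'cV[R]_m => qform Q (u - mu)).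
  by apply: continuous_bform => i; under eq_fun do rewrite !mxE;
    apply: continuous_sub; try exact: continuous_const; exact: coord_continuous.
apply: continuous_mul.
  apply: continuous_mul; first exact: continuous_const.
  apply: continuous_exp; apply: continuous_mul; last exact: continuous_const.
  exact: continuous_opp.
apply: continuous_exp; apply: continuous_mul; last exact: continuous_const.
exact: continuous_opp.
Qed.

Lemma mppi_weight_gt0 mu u : 0 < mppi_weight mu u.
Proof.
rewrite mulr_gt0 ?expR_gt0// mulr_gt0 ?expR_gt0// invr_gt0 sqrtr_gt0.
by rewrite mulr_gt0 ?posdef_det_gt0// exprn_gt0// mulr_gt0// pi_gt0.
Qed.

Lemma mppi_Z_gt0 mu : 0 < mppi_Z C f0 tau Sigma mu.
Proof.
by apply: weight_gt0 => //; [exact: mppi_weight_cont|exact: mppi_weight_gt0].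
Qed.

Lemma Rintegral_rho mu (h : 'cV[R]_m -> R) : continuous h ->
  \int[lebesgue_Rn m]_u (h u * rho mu u) = wmean C (mppi_weight mu) h.
Proof.
move=> ch; rewrite /wmean -RintegralZr; last 2 first.
- exact: compact_measurable_colvec.
- apply: continuous_integrable => //; apply: continuous_mul => //.
  exact: mppi_weight_cont.
rewrite [RHS]Rintegral_mkcond; apply: eq_Rintegral => u _.
rewrite /mppi_rho patchE indicE; case: ifP => _.
  by rewrite mulr1 mulrA.
by rewrite mulr0 mul0r mulr0.
Qed.

Lemma pdf_meanE mu i :
  mean mu i 0 = wmean C (mppi_weight mu) (fun u => u i 0).
Proof. by rewrite mxE Rintegral_rho//; exact: coord_continuous. Qed.

Lemma wmean_bform mu (A : 'M[R]_m) z :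
  wmean C (mppi_weight mu) (fun u => bform A z u) = bform A z (mean mu).
Proof.
have wc := @mppi_weight_cont mu.
have cc i : continuous (fun u : 'cV[R]_m => u i 0) by exact: coord_continuous.
rewrite bformE; under eq_wmean do rewrite bformE.
rewrite wmean_sum//; last first.
  move=> i; apply: continuous_bigsum => j.
  by apply: continuous_mul => //; exact: continuous_const.
apply: eq_bigr => i _; rewrite wmean_sum//; last first.
  by move=> j; apply: continuous_mul => //; exact: continuous_const.
by apply: eq_bigr => j _; rewrite wmeanZ// pdf_meanE.
Qed.

Lemma pdf_cov_sym mu : (pdf_cov (rho mu))^T = pdf_cov (rho mu).
Proof.
apply/matrixP => i j; rewrite !mxE; apply: eq_Rintegral => u _.
by rewrite [_ * (u i 0 - _)]mulrC.
Qed.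

(** The square of [z^T (u - E u)] is expanded over pairs of coordinates and the
    mean taken term by term. *)
Lemma qform_pdf_cov mu z :
  qform (pdf_cov (rho mu)) z = wvar C (mppi_weight mu) (fun u => bform 1%:M z u).
Proof.
have wc := @mppi_weight_cont mu.
have cc i : continuous (fun u : 'cV[R]_m => u i 0 - mean mu i 0).
  by apply: continuous_sub; [exact: coord_continuous|exact: continuous_const].
have cij i j : continuous (fun u : 'cV[R]_m => z i 0 *
    ((u i 0 - mean mu i 0) * (u j 0 - mean mu j 0) * z j 0)).
  apply: continuous_mul; first exact: continuous_const.
  by apply: continuous_mul; [exact: continuous_mul|exact: continuous_const].
rewrite /wvar wmean_bform.
transitivity (wmean C (mppi_weight mu) (fun u => \sum_i \sum_j z i 0 *
    ((u i 0 - mean mu i 0) * (u j 0 - mean mu j 0) * z j 0))).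
  rewrite wmean_sum// => [|i]; last exact: continuous_bigsum.
  rewrite qformE bformE; apply: eq_bigr => i _; rewrite wmean_sum//.
  apply: eq_bigr => j _.
  have -> : (fun u : 'cV[R]_m => z i 0 * ((u i 0 - mean mu i 0) *
      (u j 0 - mean mu j 0) * z j 0)) = (fun u => z i 0 * z j 0 *
      ((u i 0 - mean mu i 0) * (u j 0 - mean mu j 0))).
    by apply/funext => u; ring.
  rewrite wmeanZ//; last exact: continuous_mul.
  by rewrite [pdf_cov _ _ _]mxE Rintegral_rho; [ring|exact: continuous_mul].
apply: eq_wmean => u; rewrite -bformNr -bformDr bform1E expr2 mulr_suml.
apply: eq_bigr => i _; rewrite mulr_sumr; apply: eq_bigr => j _.
by rewrite !mxE; ring.
Qed.

End mppi_expectations.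

(** * Gradient and Hessian of the objective *)

Section mppi_smoothness.
Context {R : realType} {m : nat}.
Variables (C : set 'cV[R]_m) (f0 : 'cV[R]_m -> R) (tau : R) (Sigma : 'M[R]_m).
Hypotheses (C_nonempty : C !=set0) (C_compact : compact C).
Hypothesis C_pos : (0 < lebesgue_Rn m C)%E.
Hypotheses (f0_cont : continuous f0) (tau_gt0 : 0 < tau).
Hypothesis Sigma_posdef : posdefmx Sigma.

Local Notation Int h := (\int[lebesgue_Rn m]_(u in C) h u).
Local Notation Q := (invmx Sigma).
Local Notation W := (invsqrtmx Sigma).
Local Notation F := (mppi_F C f0 tau Sigma).
Local Notation rho := (mppi_rho C f0 tau Sigma).
Local Notation mean mu := (pdf_mean (rho mu)).
Local Notation weight := (mppi_weight f0 tau Sigma).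
Local Notation L := (mppi_L C f0 tau Sigma).
Local Notation D := (mppi_D C Sigma).

Implicit Types (mu nu d u v : 'cV[R]_m) (t s : R) (h : 'cV[R]_m -> R).

Let Qs : Q^T = Q := invmx_posdef_sym Sigma_posdef.
Let wc mu : continuous (weight mu) :=
  @mppi_weight_cont _ _ f0 tau Sigma f0_cont mu.
Let w0 mu u : 0 < weight mu u := mppi_weight_gt0 f0 tau Sigma_posdef mu u.

(** The coefficient of [t] in the exponent of the Gaussian density of mean
    [mu + t d]. *)
Definition line_slope (mu d u : 'cV[R]_m) : R := bform Q d (u - mu).

Lemma line_slope_cont mu d : continuous (line_slope mu d).
Proof.
apply: continuous_bform => i; first exact: continuous_const.
under eq_fun do rewrite !mxE.
by apply: continuous_sub; [exact: coord_continuous|exact: continuous_const].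
Qed.

Let bc mu d := @line_slope_cont mu d.

(** Completing the square: the translated weight is a tilting of the original
    one, up to a factor that does not depend on [u]. *)
Lemma mppi_weight_line mu d t u :
  weight (mu + t *: d) u =
  expR (- (t ^+ 2 * qform Q d) / 2) * tilt (weight mu) (line_slope mu d) t u.
Proof.
rewrite /mppi_weight /gauss_pdf /tilt /line_slope.
have -> : u - (mu + t *: d) = (u - mu) - t *: d by rewrite opprD addrA.
rewrite [qform Q (_ - t *: d)]qformB// qformZ bformZr (bform_sym (u - mu) d Qs).
set q := qform Q (u - mu); set a := qform Q d; set b := bform Q d (u - mu).
rewrite (_ : - (q - _ + _) / 2 = - (t ^+ 2 * a) / 2 + (t * b + - q / 2)).
  by rewrite !expRD; ring.
by field.
Qed.

Lemma wmean_line mu d t h : continuous h ->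
  wmean C (tilt (weight mu) (line_slope mu d) t) h =
  wmean C (weight (mu + t *: d)) h.
Proof.
move=> ch; have -> : weight (mu + t *: d) = fun u =>
    expR (- (t ^+ 2 * qform Q d) / 2) * tilt (weight mu) (line_slope mu d) t u.
  by apply/funext => u; rewrite mppi_weight_line.
rewrite wmeanZ_weight ?gt_eqF ?expR_gt0//.
exact: tilt_cont.
Qed.

Lemma mppi_F_line mu d t :
  F (mu + t *: d) = tau * (t ^+ 2 * qform Q d / 2 -
    ln (Int (tilt (weight mu) (line_slope mu d) t))).
Proof.
rewrite /mppi_F /mppi_Z.
have -> : \int[lebesgue_Rn m]_(u in C) (gauss_pdf (mu + t *: d) Sigma u *
    expR (- f0 u / tau)) = expR (- (t ^+ 2 * qform Q d) / 2) *
    Int (tilt (weight mu) (line_slope mu d) t).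
  rewrite -integralZ_cont//; last exact: tilt_cont.
  by apply: eq_Rintegral => u _; exact: mppi_weight_line.
rewrite lnM ?posrE ?expR_gt0 ?partition_gt0// expRK.
by field.
Qed.

Lemma line_slope_mean mu d nu :
  wmean C (weight nu) (line_slope mu d) = bform Q d (mean nu - mu).
Proof.
rewrite bformDr bformNr -wmean_bform//.
rewrite -(wmean_cst C_nonempty C_compact C_pos (@wc nu) (w0 nu) (- bform Q d mu)).
rewrite -wmeanD//; [|exact: continuous_linear_form|exact: continuous_const].
by apply: eq_wmean => u; rewrite /line_slope bformDr bformNr.
Qed.

Lemma is_derive_mppi_F_line mu d (t : R) :
  is_derive t 1 (fun s => F (mu + s *: d))
    (tau * (t * qform Q d - wmean C (tilt (weight mu) (line_slope mu d) t)
                              (line_slope mu d))).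
Proof.
have -> : (fun s => F (mu + s *: d)) =
  tau \*: ((qform Q d / 2) \*: ((@id R) * (@id R)) -
    (fun s => ln (Int (tilt (weight mu) (line_slope mu d) s)))).
  apply/funext => s; rewrite mppi_F_line.
  rewrite -[RHS]/(tau * (qform Q d / 2 * (s * s) - ln _)).
  by congr (_ * (_ - _)); ring.
have dl := is_derive_ln_partition C_nonempty C_compact C_pos
  (@wc mu) (w0 mu) (@bc mu d) t.
apply: is_derive_eq (is_deriveZ tau (is_deriveB
  (is_deriveZ (qform Q d / 2) (is_deriveM (is_derive_id t 1) (is_derive_id t 1)))
  dl)) _.
have e (x y : R) : x *: y = x * y by [].
by rewrite !e; field.
Qed.

Lemma derive_line (f : 'cV[R]_m -> R) mu d :
  'D_d f mu = 'D_1 (fun s : R => f (mu + s *: d)) 0.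
Proof.
rewrite /derive.
suff -> : (fun h : R => h^-1 *: ((f \o shift mu) (h *: d) - f mu)) =
    (fun h : R => h^-1 *: (((fun s : R => f (mu + s *: d)) \o shift 0) (h *: 1) -
      f (mu + 0 *: d))) by [].
apply/funext => h /=.
by rewrite scale0r !addr0 [h *: 1]mulr1 [h *: d + mu]addrC.
Qed.

Lemma mppi_gradE mu : grad F mu = tau *: (Q *m (mu - mean mu)).
Proof.
apply/colP => i; rewrite [LHS]mxE [RHS]mxE derive_line.
rewrite (derive_val (is_derive := is_derive_mppi_F_line mu (delta_mx i 0) 0)).
rewrite mul0r sub0r wmean_line; last exact: line_slope_cont.
by rewrite scale0r addr0 line_slope_mean -bformNr opprB bform_delta.
Qed.

(** Along [d], the statistic is the linear form [Sigma^-1 d] up to a constant,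
    and in whitened coordinates the direction becomes [Sigma^(-1/2) d]. *)
Lemma wvar_line mu d t :
  wvar C (tilt (weight mu) (line_slope mu d) t) (line_slope mu d) =
  qform (W *m pdf_cov (rho (mu + t *: d)) *m W) (W *m d).
Proof.
have Ws := invsqrtmx_sym Sigma_posdef.
rewrite qformE -bformMr -{1}Ws -bformMl -qformE mulmxA invsqrtmxK//.
rewrite qform_pdf_cov// /wvar [wmean _ _ (line_slope _ _)]wmean_line//.
rewrite wmean_line; last first.
  apply: continuous_pow; apply: continuous_sub => //; exact: continuous_const.
apply: eq_wmean => u; congr (_ ^+ 2).
rewrite line_slope_mean wmean_bform// /line_slope -!bformNr -!bformDr.
rewrite bformMl Qs mulmx1; congr (bform _ _ _).
by rewrite opprB addrA subrK.
Qed.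

(** Hence the Hessian of the objective is
    [tau Sigma^(-1/2) (1 - Sigma^(-1/2) Cov Sigma^(-1/2)) Sigma^(-1/2)]. *)
Lemma is_derive2_mppi_F_line mu d (t : R) :
  is_derive t 1 (fun s : R => tau * (s * qform Q d -
      wmean C (tilt (weight mu) (line_slope mu d) s) (line_slope mu d)))
    (tau * qform (1%:M - W *m pdf_cov (rho (mu + t *: d)) *m W) (W *m d)).
Proof.
have -> : (fun s : R => tau * (s * qform Q d -
      wmean C (tilt (weight mu) (line_slope mu d) s) (line_slope mu d))) =
  tau \*: (qform Q d \*: (@id R) -
    (fun s => wmean C (tilt (weight mu) (line_slope mu d) s) (line_slope mu d))).
  apply/funext => s; rewrite -[RHS]/(tau * (qform Q d * s - _)).
  by rewrite [qform Q d * s]mulrC.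
have dl := is_derive_wmean_tilt C_nonempty C_compact C_pos
  (@wc mu) (w0 mu) (@bc mu d) t.
apply: is_derive_eq (is_deriveZ tau (is_deriveB
  (is_deriveZ (qform Q d) (is_derive_id t 1)) dl)) _.
rewrite wvar_line [in RHS]qformE bformD_mx bformN_mx -!qformE.
have -> : qform 1%:M (W *m d) = qform Q d by rewrite [in RHS]qformE bform_invmxE.
have e (x y : R) : x *: y = x * y by [].
by rewrite !e mulr1.
Qed.

Lemma enorm_whitened d : enorm (W *m d) ^+ 2 = qform Q d.
Proof. by rewrite enorm_sqr [in RHS]qformE bform_invmxE. Qed.

(** The supremum defining the diameter is over a bounded set: by the
    parallelogram law [q (x - y) <= 2 q x + 2 q y], and [q] is bounded on [C]. *)
Lemma mppi_diam_ub u v : C u -> C v -> enorm (W *m (u - v)) <= D.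
Proof.
move=> Cu Cv.
have cq : continuous (fun u : 'cV[R]_m => qform Q u).
  by apply: continuous_bform => i; exact: coord_continuous.
have [M _ hM] := compact_EVT_max C_nonempty C_compact (continuous_subspaceT cq).
apply: sup_ubound; last by exists (u, v).
exists (Num.sqrt (4 * qform Q M)) => _ [[x y] [/= Cx Cy] <-].
have qx := hM x (mem_set Cx); have qy := hM y (mem_set Cy).
rewrite -(ger0_norm (enorm_ge0 _)) -sqrtr_sqr enorm_whitened ler_wsqrtr//.
have := qformD x y Qs; have := qformB x y Qs.
have : 0 <= qform Q (x + y) by rewrite -enorm_whitened sqr_ge0.
lra.
Qed.

(** In whitened coordinates the covariance form lies between [0] and [D^2/4],
    the latter by Popoviciu's inequality in every direction. *)
Lemma mppi_hessian_le mu (y : 'cV[R]_m) :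
  `|qform (1%:M - W *m pdf_cov (rho mu) *m W) y| <=
  Num.max 1 (D ^+ 2 / 4 - 1) * enorm y ^+ 2.
Proof.
have Ws := invsqrtmx_sym Sigma_posdef.
have -> : qform (1%:M - W *m pdf_cov (rho mu) *m W) y =
    enorm y ^+ 2 - wvar C (weight mu) (fun u => bform 1%:M (W *m y) u).
  rewrite -qform_pdf_cov// enorm_sqr qformE bformD_mx bformN_mx; congr (_ - _).
  by rewrite -bformMr -{1}Ws -bformMl.
set s := enorm y ^+ 2; set k := wvar _ _ _.
have k0 : 0 <= k by apply: wvar_ge0 => //; exact: continuous_linear_form.
have kD : k <= s * (D ^+ 2 / 4).
  have -> : s * (D ^+ 2 / 4) = (enorm y * D) ^+ 2 / 4 by rewrite /s; field.
  apply: wvar_le => //; first exact: continuous_linear_form.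
  move=> u v Cu Cv; rewrite -bformNr -bformDr bformMl mulmx1 Ws.
  rewrite -{1}[W]mul1mx -bformMr (le_trans (ler_norm _))//.
  rewrite (le_trans (cauchy_schwarz _ _))// ler_wpM2l ?enorm_ge0//.
  exact: mppi_diam_ub.
have s0 : 0 <= s by exact: sqr_ge0.
have c1 : s * 1 <= s * Num.max 1 (D ^+ 2 / 4 - 1).
  by rewrite ler_wpM2l// le_max lexx.
have c2 : s * (D ^+ 2 / 4 - 1) <= s * Num.max 1 (D ^+ 2 / 4 - 1).
  by rewrite ler_wpM2l// le_max lexx orbT.
rewrite [leRHS]mulrC ler_norml; apply/andP; split; lra.
Qed.

Lemma mppi_hessian_sym mu :
  (1%:M - W *m pdf_cov (rho mu) *m W)^T = 1%:M - W *m pdf_cov (rho mu) *m W.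
Proof.
by rewrite linearB /= trmx1 !trmx_mul invsqrtmx_sym// pdf_cov_sym mulmxA.
Qed.

Lemma mppi_L_le : (L <= (Num.max 1 (D ^+ 2 / 4 - 1))%:E)%E.
Proof.
apply: ge_ereal_sup => _ [mu _ <-]; rewrite lee_fin.
apply: spectral_norm_le => [|x]; first by rewrite le_max ler01.
by apply: sym_form_le (mppi_hessian_le mu); exact: mppi_hessian_sym.
Qed.

(** Passing from the extended supremum to its real value loses nothing because
    the supremum is finite. *)
Lemma mppi_L_ge mu :
  spectral_norm (1%:M - W *m pdf_cov (rho mu) *m W) <= fine L.
Proof.
have Lge : ((spectral_norm (1%:M - W *m pdf_cov (rho mu) *m W))%:E <= L)%E.
  by apply: ereal_sup_ubound; exists mu.
have Lfin : L \is a fin_num.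
  apply/fin_numPlt; rewrite (lt_le_trans _ Lge) ?ltNyr//=.
  by rewrite (le_lt_trans mppi_L_le) ?ltry.
by rewrite -lee_fin fineK.
Qed.

(** The second-order bound along the segment from [mu] to [mu + d], the form of
    the Hessian being at most its spectral norm times the squared length. *)
Lemma mppi_F_smooth mu d :
  F (mu + d) <= F mu + tau * bform Q d (mu - mean mu)
    + tau * fine L * qform Q d / 2.
Proof.
have := taylor2_le (K := tau * fine L * qform Q d)
  (is_derive_mppi_F_line mu d) (is_derive2_mppi_F_line mu d).
rewrite /= scale1r scale0r addr0 mul0r sub0r wmean_line; last exact: bc.
rewrite scale0r addr0 line_slope_mean -bformNr opprB; apply=> t.
rewrite -mulrA ler_pM2l// -enorm_whitened.
rewrite (le_trans (qform_le_spectral_norm _ _))// ler_wpM2r ?sqr_ge0//.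
exact: mppi_L_ge.
Qed.

Lemma pnorm_grad_sqr mu : pnorm (tau^-1 *: Sigma) (grad F mu) ^+ 2 =
  tau * qform Q (mu - mean mu).
Proof.
have Su := posdef_unitmx Sigma_posdef.
have -> : tau * qform Q (mu - mean mu) = qform (tau^-1 *: Sigma) (grad F mu).
  rewrite mppi_gradE qformZ [in RHS]qformE bformZ_mx bformMr bformMl Qs.
  by rewrite mulmxA mulVmx// mul1mx -qformE; field; rewrite gt_eqF.
rewrite sqr_sqrtr//.
rewrite qformE bformZ_mx -qformE mulr_ge0 ?invr_ge0 ?(ltW tau_gt0)//.
exact: (posdef_psd Sigma_posdef).2.
Qed.

(** The update is [mu - eta e] with [e = mu - E u], and [e] is [Sigma / tau]
    applied to the gradient; so the linear and quadratic terms of the upper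
    model are both multiples of [tau e^T Sigma^-1 e], the squared gradient
    norm. *)
Lemma mppi_descent mu eta :
  F ((1 - eta) *: mu + eta *: mean mu) <=
  F mu - eta * (1 - eta * fine L / 2) *
    pnorm (tau^-1 *: Sigma) (grad F mu) ^+ 2.
Proof.
set e := mu - mean mu.
have -> : (1 - eta) *: mu + eta *: mean mu = mu + (- eta) *: e.
  by rewrite /e scalerBl scale1r scaleNr scalerBr opprB -!addrA [- _ + _]addrC.
rewrite (le_trans (mppi_F_smooth _ _))// -/e pnorm_grad_sqr -/e.
by rewrite bformZl -qformE qformZ le_eqVlt; apply/orP; left; apply/eqP; field.
Qed.

(** The Gaussian factor is at most its normalising constant, which bounds the
    partition function from above uniformly in the mean. *)
Lemma mppi_F_bounded : exists B, forall mu, B <= F mu.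
Proof.
pose K := (Num.sqrt ((2 * pi) ^+ m * \det Sigma))^-1.
have K0 : 0 < K.
  rewrite invr_gt0 sqrtr_gt0 mulr_gt0 ?posdef_det_gt0//.
  by rewrite exprn_gt0// mulr_gt0// pi_gt0.
pose E u := K * expR (- f0 u / tau).
have cE : continuous E.
  apply: continuous_mul; first exact: continuous_const.
  apply: continuous_exp; apply: continuous_mul; first exact: continuous_opp.
  exact: continuous_const.
have IE : 0 < Int E.
  by apply: integral_cont_gt0 => // u _; rewrite mulr_gt0 ?expR_gt0.
exists (- tau * ln (Int E)) => mu.
rewrite /mppi_F ler_wnM2l ?oppr_le0 ?(ltW tau_gt0)//.
rewrite ler_ln ?posrE ?mppi_Z_gt0//; apply: le_integral_cont => // [|u _].
  exact: wc.
rewrite /E ler_wpM2r ?expR_ge0// -[leRHS]mulr1 ler_wpM2l ?(ltW K0)//.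
rewrite -expR0 ler_expR.
by rewrite mulNr oppr_le0 divr_ge0// -enorm_whitened sqr_ge0.
Qed.

End mppi_smoothness.

(** * Convergence of descent sequences *)

Section descent_sequences.
Context {R : realType}.
Variables (a s : nat -> R) (c B : R).
Hypotheses (c_gt0 : 0 < c) (s_ge0 : forall k, 0 <= s k).
Hypothesis a_ge : forall k, B <= a k.
Hypothesis a_descent : forall k, a k.+1 <= a k - c * s k.

Lemma descent_partial_sum n : \sum_(0 <= k < n) s k <= (a 0%N - B) / c.
Proof.
have tele : c * \sum_(0 <= k < n) s k <= a 0%N - a n.
  elim: n => [|n IHn]; first by rewrite big_geq// mulr0 subrr.
  rewrite big_nat_recr//= mulrDr; have := a_descent n; lra.
by rewrite ler_pdivlMr// mulrC (le_trans tele)// lerB.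
Qed.

Lemma descent_series_le :
  (\sum_(0 <= k <oo) (s k)%:E <= ((a 0%N - B) / c)%:E)%E.
Proof.
apply: lime_le; first by apply: is_cvg_nneseries => k _ _; rewrite lee_fin.
by apply: nearW => n; rewrite sumEFin lee_fin descent_partial_sum.
Qed.

Lemma descent_cvg0 : s @ \oo --> 0.
Proof.
apply: cvg_series_cvg_0; apply: nnseries_is_cvg => //.
by apply: le_lt_trans descent_series_le _; exact: ltry.
Qed.

Lemma descent_min_le K : (1 <= K)%N ->
  \big[Num.min/s 0%N]_(0 <= j < K) s j <= (a 0%N - B) / (K%:R * c).
Proof.
move=> K1; have K0 : 0 < K%:R :> R by rewrite ltr0n.
set mn := \big[_/_]_(_ <= _ < _) _.
have mn_le k : (k < K)%N -> mn <= s k.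
  move=> kK; rewrite /mn big_mkord.
  exact: (bigmin_le (s 0%N) (Ordinal kK) (fun i => s i)).
rewrite invfM mulrCA ler_pdivlMl//; apply: le_trans (descent_partial_sum K).
rewrite mulr_natl -[K in leLHS]subn0 -sumr_const_nat.
by rewrite !big_mkord; apply: ler_sum => k _; exact: mn_le.
Qed.

End descent_sequences.

(** * Convergence of the relaxed update *)

Theorem theorem2 (R : realType) (m : nat) (C : set 'cV[R]_m)
    (f0 : 'cV[R]_m -> R) (tau : R) (Sigma : 'M[R]_m)
    (C_nonempty : C !=set0) (C_compact : compact C)
    (C_pos : (0 < lebesgue_Rn m C)%E)
    (f0_cont : continuous f0) (tau_gt0 : 0 < tau)
    (Sigma_posdef : posdefmx Sigma) :
  let F := mppi_F C f0 tau Sigma in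
  let rho := mppi_rho C f0 tau Sigma in
  let D := mppi_D C Sigma in
  let P := tau^-1 *: Sigma in
  (mppi_L C f0 tau Sigma <= (Num.max 1 (D ^+ 2 / 4 - 1))%:E)%E /\
  (* the bound above makes the supremum finite *)
  let L := fine (mppi_L C f0 tau Sigma) in
  forall eta : R, 0 < eta -> eta < 2 / L ->
  forall mu : nat -> 'cV[R]_m,
    (forall k, mu k.+1 = (1 - eta) *: mu k + eta *: pdf_mean (rho (mu k))) ->
  let g k := pnorm P (grad F (mu k)) in
  let c := eta * (1 - eta * L / 2) in
  let Finf := inf (range F) in
  [/\ forall k, F (mu k.+1) <= F (mu k) - c * g k ^+ 2,
      (\sum_(0 <= k <oo) (g k ^+ 2)%:E <= ((F (mu 0%N) - Finf) / c)%:E)%E,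
      (* [g 0 ^+ 2], the value for j = 0, is the unit of the iterated min *)
      forall K : nat, (1 <= K)%N ->
        \big[Num.min/g 0%N ^+ 2]_(0 <= j < K) (g j ^+ 2)
          <= (F (mu 0%N) - Finf) / (K%:R * c)
    & g @ \oo --> 0].
Proof.
move=> F rho D P; split; first exact: mppi_L_le.
move=> L eta eta0 etaL mu mu_step g c Finf.
(* A step size below [2 / L] forces [L > 0], division by zero being zero. *)
have L0 : 0 < L by rewrite -invr_gt0 -(@pmulr_rgt0 _ 2)// (lt_trans eta0).
have c0 : 0 < c by rewrite mulr_gt0// subr_gt0 ltr_pdivrMr// mul1r -ltr_pdivlMr.
have descent k : F (mu k.+1) <= F (mu k) - c * g k ^+ 2.
  by rewrite mu_step; exact: mppi_descent.
have Finf_le k : Finf <= F (mu k).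
  apply: ge_inf; last by exists (mu k).
  have [B FB] := mppi_F_bounded C_nonempty C_compact C_pos f0_cont tau_gt0
    Sigma_posdef.
  by exists B => _ [x _ <-]; exact: FB.
have g2_ge0 k : 0 <= g k ^+ 2 by exact: sqr_ge0.
split=> //.
- exact: (descent_series_le c0 g2_ge0 Finf_le descent).
- by move=> K K1; exact: (descent_min_le c0 Finf_le descent).
- have -> : g = Num.sqrt \o (fun k => g k ^+ 2).
    by apply/funext => k /=; rewrite sqrtr_sqr ger0_norm ?sqrtr_ge0.
  rewrite -[X in _ --> X]sqrtr0.
  apply: continuous_cvg; first exact: sqrt_continuous.
  exact: (descent_cvg0 c0 g2_ge0 Finf_le descent).
Qed.
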